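(* Let $f:G\rightarrow H$ be a homomorphism of groups. There exist a topological space $X_f$ and group isomorphisms $\varphi:G\to \mathrm{Aut}(X_f)$ and $\psi:H\to\mathcal{E}(X_f)$ such that $\tau\circ\varphi=\psi\circ f$, where $\tau:\mathrm{Aut}(X_f)\to\mathcal{E}(X_f)$ is the natural homomorphism sending each homeomorphism to its homotopy class. (That is, under the identifications $\mathrm{Aut}(X_f)=G$ and $\mathcal{E}(X_f)=H$ one has $\tau=f$.)
   Context: For a topological space $X$, $\mathrm{Aut}(X)$ denotes the group of homeomorphisms $X\to X$ under composition, and $\mathcal{E}(X)$ denotes the group of (free) homotopy classes of self-homotopy equivalences $X\to X$ under composition. The natural homomorphism $\tau:\mathrm{Aut}(X)\to\mathcal{E}(X)$ sends a homeomorphism $k$ to its homotopy class $[k]$. *)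

(* Defs.v *)
From HB Require Import structures.
From mathcomp Require Import all_boot all_order all_algebra generic_quotient.
From mathcomp Require Import all_classical all_reals.
From mathcomp Require Import topology normedtype.
From mathcomp Require Import lra.

Set Implicit Arguments.
Unset Strict Implicit.
Unset Printing Implicit Defensive.

Import Order.TTheory GRing.Theory Num.Theory.
Import numFieldNormedType.Exports.

Local Open Scope classical_set_scope.
Local Open Scope ring_scope.
Local Open Scope quotient_scope.

Definition homeomorphism (X Y : topologicalType) (f : X -> Y) : Prop :=
  continuous f /\ exists g : Y -> X, [/\ continuous g, cancel f g & cancel g f].

Section Homotopy.
Context (R : realType).

(* A homotopy is a continuous map on the subspace [0, 1] x X; its values outside
   this subspace play no role. *)
Definition homotopic (X Y : topologicalType) (f g : X -> Y) : Prop :=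
  exists F : R * X -> Y,
    [/\ {within `[0, 1] `*` [set: X], continuous F},
        forall x, F (0, x) = f x & forall x, F (1, x) = g x].

Definition homotopy_equivalence (X Y : topologicalType) (f : X -> Y) : Prop :=
  continuous f /\ exists g : Y -> X,
    [/\ continuous g, homotopic (g \o f) id & homotopic (f \o g) id].

Lemma within_continuous_comp (X Y Z : topologicalType) (A : set X) (B : set Y)
    (f : X -> Y) (g : Y -> Z) :
  continuous f -> f @` A `<=` B ->
  {within B, continuous g} -> {within A, continuous (g \o f)}.
Proof.
move=> cf fAB /subspace_continuousP cg; apply/subspace_continuousP => x Ax.
have Bfx : B (f x) by apply: fAB; exists x.
move=> U nU.
have BU : nbhs (f x) [set y | B y -> U (g y)] := cg _ Bfx U nU.
have fU : nbhs x [set z | B (f z) -> U (g (f z))] := cf x _ BU.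
suff : nbhs x [set z | A z -> U (g (f z))] by [].
by apply: filterS fU => z /= + Az; apply; apply: fAB; exists z.
Qed.

Lemma continuous_pair_map (X Y : topologicalType) (h : R -> R) (k : X -> Y) :
  continuous h -> continuous k ->
  continuous (fun p : R * X => (h p.1, k p.2)).
Proof.
move=> ch ck [t x] W [[P Q] /= [Pt Qx] PQW].
exists (h @^-1` P, k @^-1` Q); first by split; [exact: ch|exact: ck].
by move=> [t' x'] /= [Pt' Qx']; apply: PQW.
Qed.

Lemma homotopic_refl (X Y : topologicalType) (f : X -> Y) :
  continuous f -> homotopic f f.
Proof.
move=> cf; exists (f \o snd); split => //; apply: continuous_subspaceT => -[t x].
by apply: continuous_comp; [exact: cvg_snd|exact: cf].
Qed.

Lemma homotopic_sym (X Y : topologicalType) (f g : X -> Y) :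
  homotopic f g -> homotopic g f.
Proof.
move=> [F [cF F0 F1]]; exists (F \o (fun p => (1 - p.1, p.2))); split.
- apply: within_continuous_comp cF => [|_ [[t x] [/= + _] <-]].
    apply: (@continuous_pair_map X X (fun t => 1 - t) id) => t; last exact: cvg_id.
    by apply: cvgB; [exact: cvg_cst|exact: cvg_id].
  by rewrite !in_itv/= => /andP[t0 t1]; rewrite subr_ge0 t1 gerBl.
- by move=> x /=; rewrite subr0.
- by move=> x /=; rewrite subrr.
Qed.

Lemma homotopic_trans (X Y : topologicalType) (f g h : X -> Y) :
  homotopic f g -> homotopic g h -> homotopic f h.
Proof.
move=> [F [cF F0 F1]] [G [cG G0 G1]].
pose F' := F \o (fun p : R * X => (2 * p.1, p.2)).
pose G' := G \o (fun p : R * X => (2 * p.1 - 1, p.2)).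
pose K (p : R * X) := if p.1 <= 2^-1 then F' p else G' p.
have half2 : 2 * 2^-1 = 1 :> R by rewrite divff// pnatr_eq0.
have cl (a b : R) : closed (`[a, b] `*` [set: X]).
  rewrite (_ : _ `*` _ = fst @^-1` `[a, b]); last first.
    by apply/seteqP; split => -[t x] //= [].
  by apply: preimage_closed; [move=> p _; exact: cvg_fst|exact: itv_closed].
have cK1 : {within `[0, 2^-1] `*` [set: X], continuous K}.
  apply: (@subspace_eq_continuous _ _ _ F').
    by move=> [t x]; rewrite inE/= in_itv/= => -[/andP[_ t1] _]; rewrite /from_subspace/= /K/= t1.
  apply: within_continuous_comp cF => [|_ [[t x] [/= + _] <-]].
    apply: (@continuous_pair_map X X (fun t => 2 * t) id) => t; last exact: cvg_id.
    by apply: cvgM; [exact: cvg_cst|exact: cvg_id].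
  rewrite !in_itv/= => /andP[t0 t1]; split => //.
  by apply/andP; split; lra.
have cK2 : {within `[2^-1, 1] `*` [set: X], continuous K}.
  apply: (@subspace_eq_continuous _ _ _ G').
    move=> [t x]; rewrite inE/= in_itv/= => -[/andP[t1 _] _]; rewrite /from_subspace/= /K/=.
    case: ifPn => // t2; have -> : t = 2^-1 by lra.
    by rewrite /F' /G' /= half2 subrr F1 G0.
  apply: within_continuous_comp cG => [|_ [[t x] [/= + _] <-]].
    apply: (@continuous_pair_map X X (fun t => 2 * t - 1) id) => t; last exact: cvg_id.
    apply: cvgB; last exact: cvg_cst.
    by apply: cvgM; [exact: cvg_cst|exact: cvg_id].
  rewrite !in_itv/= => /andP[t0 t1]; split => //.
  by apply/andP; split; lra.
exists K; split.
- apply: continuous_subspaceW (withinU_continuous (cl _ _) (cl _ _) cK1 cK2).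
  move=> [t x] [/=]; rewrite !in_itv/= => /andP[t0 t1] _.
  by have [tt|tt] := leP t 2^-1; [left|right]; split => //;
    apply/andP; split; lra.
- by move=> x; rewrite /K/= invr_ge0 ler0n /F'/= mulr0.
- move=> x; rewrite /K/= ifF; last by apply/negbTE; rewrite -ltNge; lra.
  by rewrite /G'/= mulr1 (_ : 2 - 1 = 1) //; lra.
Qed.

Lemma homotopic_comp (X Y Z : topologicalType) (f f' : X -> Y) (g g' : Y -> Z) :
  continuous f -> continuous g' ->
  homotopic f f' -> homotopic g g' -> homotopic (g \o f) (g' \o f').
Proof.
move=> cf cg' [F [cF F0 F1]] [G [cG G0 G1]].
apply: (@homotopic_trans _ _ _ (g' \o f)).
- exists (G \o (fun p : R * X => (p.1, f p.2))); split.
  + apply: within_continuous_comp cG => [|_ [[t x] [/= + _] <-]] //.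
    by apply: (@continuous_pair_map X Y id f) => // t; exact: cvg_id.
  + by move=> x /=; rewrite G0.
  + by move=> x /=; rewrite G1.
- exists (g' \o F); split.
  + by move=> x; exact: (cvg_comp _ g' (cF x) (cg' (F x))).
  + by move=> x /=; rewrite F0.
  + by move=> x /=; rewrite F1.
Qed.

End Homotopy.

Section Aut.
Context (X : topologicalType).

Record Aut := MkAut {
  Aut_fun :> X -> X;
  Aut_homeo : homeomorphism Aut_fun }.

HB.instance Definition _ := gen_eqMixin Aut.
HB.instance Definition _ := gen_choiceMixin Aut.

Lemma AutP (h k : Aut) : h =1 k -> h = k.
Proof.
case: h k => [h hP] [k kP] /= /funext hk; case: _ / hk kP => kP.
by congr MkAut; exact: Prop_irrelevance.
Qed.

Lemma homeomorphism_id : homeomorphism (@id X).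
Proof. by split=> [x|]; [|exists id; split => // x]; exact: cvg_id. Qed.

Lemma homeomorphism_comp (h k : Aut) : homeomorphism (h \o k).
Proof.
case: h k => [h [ch [h' [ch' hK h'K]]]] [k [ck [k' [ck' kK k'K]]]] /=.
split=> [x|]; first by apply: continuous_comp; [exact: ck|exact: ch].
exists (k' \o h'); split; [|exact: can_comp|exact: can_comp].
by move=> x; apply: continuous_comp; [exact: ch'|exact: ck'].
Qed.

Definition Aut_inv_fun (h : Aut) : X -> X := projT1 (cid (Aut_homeo h).2).

Lemma Aut_inv_funP (h : Aut) :
  [/\ continuous (Aut_inv_fun h), cancel h (Aut_inv_fun h)
    & cancel (Aut_inv_fun h) h].
Proof. by rewrite /Aut_inv_fun; case: cid. Qed.

Lemma homeomorphism_inv (h : Aut) : homeomorphism (Aut_inv_fun h).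
Proof.
have [ci hK hK'] := Aut_inv_funP h.
by split => //; exists h; split => //; case: (Aut_homeo h).
Qed.

Definition Aut_one := MkAut homeomorphism_id.
Definition Aut_mul (h k : Aut) := MkAut (homeomorphism_comp h k).
Definition Aut_inv (h : Aut) := MkAut (homeomorphism_inv h).

Fact Aut_mulA : associative Aut_mul. Proof. by move=> h k l; apply: AutP. Qed.
Fact Aut_mul1 : left_id Aut_one Aut_mul. Proof. by move=> h; apply: AutP. Qed.
Fact Aut_mulr1 : right_id Aut_one Aut_mul. Proof. by move=> h; apply: AutP. Qed.
Fact Aut_mulV : left_inverse Aut_one Aut_inv Aut_mul.
Proof. by move=> h; apply: AutP => x /=; case: (Aut_inv_funP h). Qed.
Fact Aut_mulrV : right_inverse Aut_one Aut_inv Aut_mul.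
Proof. by move=> h; apply: AutP => x /=; case: (Aut_inv_funP h). Qed.

HB.instance Definition _ :=
  isGroup.Build Aut Aut_mulA Aut_mul1 Aut_mulr1 Aut_mulV Aut_mulrV.

End Aut.

Section Eself.
Context (R : realType) (X : topologicalType).

Record selfHE := MkSelfHE {
  selfHE_fun :> X -> X;
  selfHE_equiv : homotopy_equivalence R selfHE_fun }.

HB.instance Definition _ := gen_eqMixin selfHE.
HB.instance Definition _ := gen_choiceMixin selfHE.

Lemma selfHE_continuous (f : selfHE) : continuous f.
Proof. by case: (selfHE_equiv f). Qed.

Definition htpy (f g : selfHE) : bool := `[< homotopic R f g >].

Lemma htpy_refl : reflexive htpy.
Proof. by move=> f; apply/asboolP/homotopic_refl/selfHE_continuous. Qed.

Lemma htpy_sym : symmetric htpy.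
Proof. by move=> f g; apply/asboolP/asboolP; exact: homotopic_sym. Qed.

Lemma htpy_trans : transitive htpy.
Proof.
by move=> g f h /asboolP fg /asboolP gh; apply/asboolP/(homotopic_trans fg gh).
Qed.

Canonical htpy_equiv_rel := EquivRel htpy htpy_refl htpy_sym htpy_trans.

Definition Eself := {eq_quot htpy}.

HB.instance Definition _ := Choice.on Eself.
HB.instance Definition _ := EqQuotient.on Eself.

Lemma EselfP (f g : selfHE) : \pi_Eself f = \pi_Eself g <-> homotopic R f g.
Proof.
split=> [/eqmodP/asboolP//|fg]; apply/eqmodP/asboolP; exact: fg.
Qed.

Lemma homotopy_equivalence_id : homotopy_equivalence R (@id X).
Proof.
have cid : continuous (@id X) by move=> x; exact: cvg_id.
by split => //; exists id; split => //; exact: homotopic_refl.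
Qed.

Lemma homotopy_equivalence_comp (f g : selfHE) :
  homotopy_equivalence R (f \o g).
Proof.
case: f g => [f [cf [f' [cf' fK f'K]]]] [g [cg [g' [cg' gK g'K]]]] /=.
have cc (h k : X -> X) : continuous h -> continuous k -> continuous (h \o k).
  by move=> ch ck x; apply: continuous_comp; [exact: ck|exact: ch].
have cid : continuous (@id X) by move=> x; exact: cvg_id.
split; first exact: cc.
exists (g' \o f'); split; first exact: cc.
- apply: homotopic_trans gK.
  have := @homotopic_comp R X X X _ _ _ _ cg (cc _ _ cid cid) (homotopic_refl R cg) fK.
  move=> /(@homotopic_comp R X X X _ _ g' g'); apply => //.
    by apply: (cc (f' \o f) g) => //; apply: cc.
  exact: homotopic_refl.
- apply: homotopic_trans f'K.
  have := @homotopic_comp R X X X _ _ _ _ cf' (cc _ _ cid cid) (homotopic_refl R cf') g'K.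
  move=> /(@homotopic_comp R X X X _ _ f f); apply => //.
    by apply: (cc (g \o g') f') => //; apply: cc.
  exact: homotopic_refl.
Qed.

Definition selfHE_inv_fun (f : selfHE) : X -> X :=
  projT1 (cid (selfHE_equiv f).2).

Lemma selfHE_inv_funP (f : selfHE) :
  [/\ continuous (selfHE_inv_fun f), homotopic R (selfHE_inv_fun f \o f) id
    & homotopic R (f \o selfHE_inv_fun f) id].
Proof. by rewrite /selfHE_inv_fun; case: cid. Qed.

Lemma homotopy_equivalence_inv (f : selfHE) :
  homotopy_equivalence R (selfHE_inv_fun f).
Proof.
have [ci fK fK'] := selfHE_inv_funP f.
by split => //; exists f; split => //; exact: selfHE_continuous.
Qed.

Definition selfHE_one := MkSelfHE homotopy_equivalence_id.
Definition selfHE_mul (f g : selfHE) := MkSelfHE (homotopy_equivalence_comp f g).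
Definition selfHE_inv (f : selfHE) := MkSelfHE (homotopy_equivalence_inv f).

Definition Eself_one : Eself := \pi_Eself selfHE_one.
Definition Eself_mul (a b : Eself) : Eself :=
  \pi_Eself (selfHE_mul (repr a) (repr b)).
Definition Eself_inv (a : Eself) : Eself := \pi_Eself (selfHE_inv (repr a)).

Lemma homotopic_repr (f : selfHE) : homotopic R (repr (\pi_Eself f)) f.
Proof. by apply/EselfP; rewrite reprK. Qed.

Lemma Eself_mulE (f g : selfHE) :
  Eself_mul (\pi_Eself f) (\pi_Eself g) = \pi_Eself (selfHE_mul f g).
Proof.
by apply/EselfP; apply: homotopic_comp; do ?exact: selfHE_continuous;
  exact: homotopic_repr.
Qed.

Fact Eself_mulA : associative Eself_mul.
Proof.
elim/quotW => f; elim/quotW => g; elim/quotW => h.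
rewrite (Eself_mulE g h) (Eself_mulE f g) !Eself_mulE.
by apply/EselfP/homotopic_refl; exact: selfHE_continuous.
Qed.

Fact Eself_mul1 : left_id Eself_one Eself_mul.
Proof.
elim/quotW => f; rewrite Eself_mulE.
by apply/EselfP/homotopic_refl; exact: selfHE_continuous.
Qed.

Fact Eself_mulr1 : right_id Eself_one Eself_mul.
Proof.
elim/quotW => f; rewrite Eself_mulE.
by apply/EselfP/homotopic_refl; exact: selfHE_continuous.
Qed.

Fact Eself_mulV : left_inverse Eself_one Eself_inv Eself_mul.
Proof.
move=> a; rewrite -{2}[a]reprK Eself_mulE; apply/EselfP.
by case: (selfHE_inv_funP (repr a)).
Qed.

Fact Eself_mulrV : right_inverse Eself_one Eself_inv Eself_mul.
Proof.
move=> a; rewrite -{1}[a]reprK Eself_mulE; apply/EselfP.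
by case: (selfHE_inv_funP (repr a)).
Qed.

HB.instance Definition _ :=
  isGroup.Build Eself Eself_mulA Eself_mul1 Eself_mulr1 Eself_mulV Eself_mulrV.

Lemma homeomorphism_homotopy_equivalence (k : Aut X) :
  homotopy_equivalence R k.
Proof.
have [ck [k' [ck' kK k'K]]] := Aut_homeo k.
have cid : continuous (@id X) by move=> x; exact: cvg_id.
split => //; exists k'; split => //.
- rewrite (_ : _ \o _ = id); first exact: homotopic_refl.
  by apply/funext => x /=.
- rewrite (_ : _ \o _ = id); first exact: homotopic_refl.
  by apply/funext => x /=.
Qed.

Definition tau (k : Aut X) : Eself :=
  \pi_Eself (MkSelfHE (homeomorphism_homotopy_equivalence k)).

Fact tauM : {morph tau : h k / (h * k)%g >-> (h * k)%g}.
Proof.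
move=> h k; rewrite [RHS]Eself_mulE.
by apply/EselfP/homotopic_refl; case: (Aut_homeo (h * k)%g).
Qed.

HB.instance Definition _ := isMultiplicative.Build (Aut X) Eself tau tauM.

End Eself.

Arguments tau : clear implicits.

(* Main.v *)
Require Import Defs.
From HB Require Import structures.
From mathcomp Require Import all_boot all_order all_algebra generic_quotient.
From mathcomp Require Import all_classical all_reals.
From mathcomp Require Import topology normedtype wochoice.

(* The space is an Alexandrov space (the open sets are the down-sets of a
   poset): the mapping cylinder of a monotone map from a poset built on [G] to
   a core poset built on [H].

   The core encodes the right translations of [H] by the labels [w : G + H],
   the labels being made rigid by a well-ordering. Each point of the core lies
   in a finite subset in which no point can be moved up or down in a monotone
   way, so a homotopy starting at the identity of the core stays there, by
   connectedness of [[0, 1]]. Hence the homotopy classes of self-equivalences of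
   the cylinder, which retracts onto its core, are the order automorphisms of
   the core, that is the left translations by [H].

   The same rigidity makes a homeomorphism of the cylinder restrict to a left
   translation of the core by some [a : H]; it then permutes the fibres of the
   cylinder, where commuting with the right translations of [G] forces it to be
   a left translation by some [g] with [f g = a]. *)

Set Implicit Arguments.
Unset Strict Implicit.
Unset Printing Implicit Defensive.

Import Order.TTheory GRing.Theory Num.Theory.
Import numFieldNormedType.Exports.

Local Open Scope classical_set_scope.

(** * Well-orders and their rigidity *)

Section WellOrder.
Context (W : eqType) (r : rel W).
Hypothesis r_wo : well_order r.

Let r_chain : {in <= predT, well_order r}. Proof. by move=> A _; exact: r_wo. Qed.

Lemma well_order_total : total r.
Proof. by move=> x y; exact: (wo_chainW r_chain). Qed.

Lemma well_order_refl : reflexive r.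
Proof. by move=> x; have := well_order_total x x; rewrite orbb. Qed.

Lemma well_order_anti : antisymmetric r.
Proof. by move=> x y; apply: (wo_chain_antisymmetric r_chain). Qed.

(** Whichever point of [{x, y, z}] is the least, either the claim is immediate or antisymmetry
    identifies two of the points. *)
Lemma well_order_trans : transitive r.
Proof.
move=> y x z xy yz; have [|m [[]]] := r_wo (A := pred3 x y z).
  by exists x; rewrite inE eqxx.
have xIn : x \in pred3 x y z by rewrite inE eqxx.
have yIn : y \in pred3 x y z by rewrite inE eqxx orbT.
have zIn : z \in pred3 x y z by rewrite inE eqxx !orbT.
rewrite !inE => /or3P[] /eqP-> mlb _; first exact: mlb.
  suff -> : x = y by [].
  by apply: well_order_anti; rewrite xy mlb.
suff <- : y = z by [].
by apply: well_order_anti; rewrite yz mlb.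
Qed.

(** At the least moved point [m], both [s m] and [t m] are above [m], since all points not above [m]
    are fixed; applying [s] to [m <= t m] then gives [s m <= m]. *)
Lemma well_order_rigid (s t : W -> W) :
  {homo s : x y / r x y} -> {homo t : x y / r x y} ->
  cancel s t -> cancel t s -> s =1 id.
Proof.
move=> sr tr sK tK x; apply: contrapT => sx.
pose A : {pred W} := [pred y | s y != y].
have [|m [[]]] := r_wo (A := A); first by exists x; rewrite inE; apply/eqP.
rewrite inE => /eqP sm mlb _.
have fixed y : ~~ r m y -> s y = y.
  by move=> my; apply/eqP; apply: contraR my => sy; apply: mlb; rewrite inE.
have msm : r m (s m).
  by case: (boolP (r m (s m))) => // /fixed /(can_inj sK).
have mtm : r m (t m).
  case: (boolP (r m (t m))) => // /fixed; rewrite tK => mE.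
  by case: sm; rewrite {1}mE tK.
by apply: sm; apply: well_order_anti; rewrite msm -{2}(tK m) sr.
Qed.

End WellOrder.

(** * The core poset: left translations and finite rigid subsets *)

Section Core.
Local Open Scope group_scope.
Context (H : groupType) (W : eqType) (r : rel W) (pi : W -> H).

(* [cE h w] records the translation from [h] to [h * pi w]: it lies above the
   source [cV h] and the target [cU (h * pi w)], and below [cC w'] for
   [w <= w'], which encodes the well-ordering of the labels. The point [cT] gives
   [cE h w] a second upper bound when [w] is the greatest label, [cO]
   tells [cT] from the [cC w], and [cD] tells sources from targets. *)
Inductive core := cV of H | cU of H | cO | cE of H & W | cC of W | cT | cD.

Definition core_le (x y : core) : Prop :=
  match x, y with
  | cV h, cV h' => h = h'
  | cV h, cE h' _ => h = h'
  | cV _, (cC _ | cT | cD) => True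
  | cU k, cU k' => k = k'
  | cU k, cE h w => k = h * pi w
  | cU _, (cC _ | cT) => True
  | cO, (cO | cC _ | cD) => True
  | cE h w, cE h' w' => h = h' /\ w = w'
  | cE _ w, cC w' => r w w'
  | cE _ _, cT => True
  | cC w, cC w' => w = w'
  | cT, cT => True
  | cD, cD => True
  | _, _ => False
  end.

Definition core_mul (a : H) (x : core) : core :=
  match x with
  | cV h => cV (a * h)
  | cU h => cU (a * h)
  | cE h w => cE (a * h) w
  | _ => x
  end.

Lemma core_mul1 x : core_mul 1 x = x.
Proof. by case: x => //= *; rewrite mul1g. Qed.

Lemma core_mulM a b x : core_mul (a * b) x = core_mul a (core_mul b x).
Proof. by case: x => //= *; rewrite mulgA. Qed.

Lemma core_mulK a : cancel (core_mul a) (core_mul a^-1).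
Proof. by move=> x; rewrite -core_mulM mulVg core_mul1. Qed.

Lemma core_mulVK a : cancel (core_mul a^-1) (core_mul a).
Proof. by move=> x; rewrite -core_mulM mulgV core_mul1. Qed.

(** The relation [k = h * pi w] survives because left and right multiplications commute. *)
Lemma core_mul_homo a x y :
  core_le x y -> core_le (core_mul a x) (core_mul a y).
Proof.
by case: x => [?|?||? ?|?||]; case: y => [?|?||? ?|?||] //=;
  intuition (subst; rewrite ?mulgA).
Qed.

Hypothesis r_wo : well_order r.

Lemma core_le_refl x : core_le x x.
Proof. by case: x. Qed.

Lemma core_le_anti x y : core_le x y -> core_le y x -> x = y.
Proof.
by case: x => [?|?||? ?|?||]; case: y => [?|?||? ?|?||] //=;
  intuition (subst => //).
Qed.

Lemma core_le_trans y x z : core_le x y -> core_le y z -> core_le x z.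
Proof.
by case: x => [?|?||? ?|?||]; case: y => [?|?||? ?|?||] //=;
  case: z => [?|?||? ?|?||] //=; intuition (subst => //);
  exact: well_order_trans _ _ _.
Qed.

(** All points other than the [cE] are minimal or maximal, so the order alone singles out the
    [cE]. *)
Lemma core_between x y z : core_le x y -> core_le y z -> x <> y -> y <> z ->
  exists h w, y = cE h w.
Proof.
by case: x => [?|?||? ?|?||]; case: y => [?|?||? ?|?||] //=;
  case: z => [?|?||? ?|?||] //=; intuition (subst => //); do 2 eexists.
Qed.

Context (w1 w2 : W).
Hypothesis (w12 : w1 <> w2) (pi_w1 : pi w1 = 1) (pi_w2 : pi w2 = 1).

(* A finite set to which the rigidity argument applies: in it, each [cV], [cU],
   [cO] lies below two points, each [cC], [cT], [cD] above two points, and each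
   [cE] both, that determine it. *)
Definition core_star (h : H) (w : W) : seq core :=
  let k := h * pi w in
  [:: cV h; cU h; cV k; cU k; cE h w1; cE h w2; cE k w1; cE k w2; cE h w;
      cC w1; cC w2; cC w; cT; cO; cD].

Lemma core_starP x : exists h w, List.In x (core_star h w).
Proof.
by case: x => [h|h||h w|w||]; [exists h, w1|exists h, w1|exists 1, w1|
  exists h, w|exists 1, w|exists 1, w1|exists 1, w1] => /=; tauto.
Qed.

(** The argument climbs from the minimal points, which [g] must fix: any other point is the only one
    below itself that lies above two suitable fixed points. *)
Lemma core_star_le h w (g : core -> core) :
  (forall x y, core_le x y -> core_le (g x) (g y)) ->
  (forall x, List.In x (core_star h w) -> core_le (g x) x) ->
  forall x, List.In x (core_star h w) -> g x = x.
Proof.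
move=> gm; rewrite /core_star; set k := h * pi w => gS.
have fixV a : List.In (cV a) (core_star h w) -> g (cV a) = cV a.
  by move=> /gS; case: (g _) => //= ? ->.
have fixU a : List.In (cU a) (core_star h w) -> g (cU a) = cU a.
  by move=> /gS; case: (g _) => //= ? ->.
have fixO : g cO = cO.
  have : core_le (g cO) cO by apply: gS => /=; tauto.
  by case: (g _).
have fixE a b : List.In (cE a b) (core_star h w) ->
    List.In (cV a) (core_star h w) -> List.In (cU (a * pi b)) (core_star h w) ->
    g (cE a b) = cE a b.
  move=> /gS + /fixV gV /fixU gU.
  have := gm (cV a) (cE a b) erefl; rewrite gV.
  have := gm (cU (a * pi b)) (cE a b) erefl; rewrite gU.
  by case: (g (cE a b)) => //= ? ? _ _ [-> ->].
have fixC a b : List.In (cC b) (core_star h w) -> g (cE a b) = cE a b ->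
    g (cC b) = cC b.
  move=> /gS + gE.
  have := gm cO (cC b) I; rewrite fixO.
  have := gm (cE a b) (cC b) (well_order_refl r_wo b); rewrite gE.
  by case: (g (cC b)) => //= ? _ _ ->.
have E1 : g (cE h w1) = cE h w1.
  by apply: fixE => /=; rewrite ?pi_w1 ?mulg1; tauto.
have E2 : g (cE h w2) = cE h w2.
  by apply: fixE => /=; rewrite ?pi_w2 ?mulg1; tauto.
have E3 : g (cE k w1) = cE k w1.
  by apply: fixE => /=; rewrite ?pi_w1 ?mulg1; tauto.
have E4 : g (cE k w2) = cE k w2.
  by apply: fixE => /=; rewrite ?pi_w2 ?mulg1; tauto.
have E5 : g (cE h w) = cE h w.
  by apply: fixE => /=; tauto.
(* A single [cE] cannot be above both [cE h w1] and [cE h w2], so [g cT] is not a [cE]. *)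
have fixT : g cT = cT.
  have : core_le (g cT) cT by apply: gS => /=; tauto.
  have := gm (cE h w1) cT I; rewrite E1.
  have := gm (cE h w2) cT I; rewrite E2.
  by case: (g cT) => //= ? ? [_ <-] [_ /w12].
have fixD : g cD = cD.
  have : core_le (g cD) cD by apply: gS => /=; tauto.
  have := gm cO cD I; rewrite fixO.
  have := gm (cV h) cD I; rewrite fixV /=; last by tauto.
  by case: (g cD).
have C1 : g (cC w1) = cC w1 by apply: (fixC h) => //=; tauto.
have C2 : g (cC w2) = cC w2 by apply: (fixC h) => //=; tauto.
have C3 : g (cC w) = cC w by apply: (fixC h) => //=; tauto.
by move=> x; do 15 (case; [move=> <- //; (apply: fixV || apply: fixU) => /=; tauto|]).
Qed.

(** The dual descent, from the maximal points, which [g] must fix. *)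
Lemma core_star_ge h w (g : core -> core) :
  (forall x y, core_le x y -> core_le (g x) (g y)) ->
  (forall x, List.In x (core_star h w) -> core_le x (g x)) ->
  forall x, List.In x (core_star h w) -> g x = x.
Proof.
move=> gm; rewrite /core_star; set k := h * pi w => gS.
have fixC b : List.In (cC b) (core_star h w) -> g (cC b) = cC b.
  by move=> /gS; case: (g _) => //= ? ->.
have fixT : g cT = cT.
  have : core_le cT (g cT) by apply: gS => /=; tauto.
  by case: (g _).
have fixD : g cD = cD.
  have : core_le cD (g cD) by apply: gS => /=; tauto.
  by case: (g _).
have fixE a b : List.In (cE a b) (core_star h w) ->
    List.In (cC b) (core_star h w) -> g (cE a b) = cE a b.
  move=> /gS + /fixC gC.
  have := gm (cE a b) (cC b) (well_order_refl r_wo b); rewrite gC.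
  have := gm (cE a b) cT I; rewrite fixT.
  by case: (g (cE a b)) => //= ? ? _ _ [-> ->].
have E1 : g (cE h w1) = cE h w1 by apply: fixE => /=; tauto.
have E2 : g (cE h w2) = cE h w2 by apply: fixE => /=; tauto.
have E3 : g (cE k w1) = cE k w1 by apply: fixE => /=; tauto.
have E4 : g (cE k w2) = cE k w2 by apply: fixE => /=; tauto.
have E5 : g (cE h w) = cE h w by apply: fixE => /=; tauto.
have fixO : g cO = cO.
  have : core_le cO (g cO) by apply: gS => /=; tauto.
  have := gm cO (cC w1) I; rewrite fixC /=; last by tauto.
  have := gm cO cD I; rewrite fixD.
  by case: (g cO).
(* Since [w1] and [w2] have trivial value, [cV a] and [cU a] both lie below the distinct points
   [cE a w1] and [cE a w2], and so cannot move up to a [cE]. *)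
have fixV a : List.In (cV a) (core_star h w) ->
    g (cE a w1) = cE a w1 -> g (cE a w2) = cE a w2 -> g (cV a) = cV a.
  move=> /gS + e1 e2.
  have := gm (cV a) (cE a w1) erefl; rewrite e1.
  have := gm (cV a) (cE a w2) erefl; rewrite e2.
  by case: (g (cV a)) => //= [? _ _ ->|? ? [_ ->] [_ /esym/w12]].
have fixU a : List.In (cU a) (core_star h w) ->
    g (cE a w1) = cE a w1 -> g (cE a w2) = cE a w2 -> g (cU a) = cU a.
  move=> /gS + e1 e2.
  have := gm (cU a) (cE a w1); rewrite e1 /= pi_w1 mulg1 => /(_ erefl).
  have := gm (cU a) (cE a w2); rewrite e2 /= pi_w2 mulg1 => /(_ erefl).
  by case: (g (cU a)) => //= [? _ _ ->|? ? [_ ->] [_ /esym/w12]].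
move=> x; do 15 (case; [move=> <- //; solve
  [apply: fixV => //=; tauto | apply: fixU => //=; tauto | apply: fixC => /=; tauto]|]).
by [].
Qed.

(** * Order automorphisms of the core *)

Section Automorphism.
Context (m n : core -> core).
Hypotheses (m_homo : forall x y, core_le x y -> core_le (m x) (m y))
           (n_homo : forall x y, core_le x y -> core_le (n x) (n y))
           (mK : cancel m n) (nK : cancel n m).

Lemma core_aut_E h w : exists h' w', m (cE h w) = cE h' w'.
Proof.
apply: (@core_between (m (cV h)) _ (m cT)).
- exact: m_homo.
- exact: m_homo.
- by move=> /(can_inj mK).
- by move=> /(can_inj mK).
Qed.

End Automorphism.

Section AutomorphismKinds.
Context (m n : core -> core).
Hypotheses (m_homo : forall x y, core_le x y -> core_le (m x) (m y))
           (n_homo : forall x y, core_le x y -> core_le (n x) (n y))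
           (mK : cancel m n) (nK : cancel n m).

Let nE h w : exists h' w', n (cE h w) = cE h' w'.
Proof. exact: core_aut_E n_homo nK _ _. Qed.

(** Only [cD] and [cO] are comparable to no [cE], and of the two only [cO] has points strictly above
    it. *)
Lemma core_aut_D : m cD = cD.
Proof.
have := mK cD; case: (m cD) => [h|h||h w|w||] //.
- have := @n_homo (cV h) (cE h w1) erefl.
  by have [? [? ->]] := nE h w1 => /[swap] ->.
- have := @n_homo (cU h) (cE h w1); rewrite /= pi_w1 mulg1 => /(_ erefl).
  by have [? [? ->]] := nE h w1 => /[swap] ->.
- move=> nO; have := @n_homo cO (cC w1) I; rewrite nO.
  case nC: (n (cC w1)) => //= _.
  by have := can_inj nK (etrans nO (esym nC)).
- by have [? [? ->]] := nE h w.
- have := @n_homo (cE 1 w) (cC w) (well_order_refl r_wo w).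
  by have [? [? ->]] := nE 1 w => /[swap] ->.
- have := @n_homo (cE 1 w1) cT I.
  by have [? [? ->]] := nE 1 w1 => /[swap] ->.
Qed.

Lemma core_aut_O : m cO = cO.
Proof.
have := mK cO; case mO: (m cO) => [h|h||h w|w||] //.
- have := @n_homo (cV h) (cE h w1) erefl.
  by have [? [? ->]] := nE h w1 => /[swap] ->.
- have := @n_homo (cU h) (cE h w1); rewrite /= pi_w1 mulg1 => /(_ erefl).
  by have [? [? ->]] := nE h w1 => /[swap] ->.
- by have [? [? ->]] := nE h w.
- have := @n_homo (cE 1 w) (cC w) (well_order_refl r_wo w).
  by have [? [? ->]] := nE 1 w => /[swap] ->.
- have := @n_homo (cE 1 w1) cT I.
  by have [? [? ->]] := nE 1 w1 => /[swap] ->.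
- by rewrite -core_aut_D mK.
Qed.

Let nO : n cO = cO. Proof. by rewrite -{1}core_aut_O mK. Qed.

(** Among the maximal points other than [cD], only [cT] is not above [cO]. *)
Lemma core_aut_T : m cT = cT.
Proof.
have := mK cT; case mT: (m cT) => [h|h||h w|w||] //.
- have := @n_homo (cV h) (cE h w1) erefl.
  by have [? [? ->]] := nE h w1 => /[swap] ->.
- have := @n_homo (cU h) (cE h w1); rewrite /= pi_w1 mulg1 => /(_ erefl).
  by have [? [? ->]] := nE h w1 => /[swap] ->.
- by rewrite nO.
- by have [? [? ->]] := nE h w.
- by have := @n_homo cO (cC w) I; rewrite nO => /[swap] ->.
- by rewrite -core_aut_D mK.
Qed.

Lemma core_aut_V h : exists h', m (cV h) = cV h'.
Proof.
have := @m_homo (cV h) cD I; rewrite core_aut_D.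
case mV: (m (cV h)) => [h'|h'||h' w|w||] //= _; first by exists h'.
  by move: mV; rewrite -core_aut_O => /(can_inj mK).
by move: mV; rewrite -core_aut_D => /(can_inj mK).
Qed.

Lemma core_aut_C w : exists w', m (cC w) = cC w'.
Proof.
have := @m_homo cO (cC w) I; rewrite core_aut_O.
case mC: (m (cC w)) => [h'|h'||h' w'|w'||] //= _; last 1 first.
- by move: mC; rewrite -core_aut_D => /(can_inj mK).
- by move: mC; rewrite -core_aut_O => /(can_inj mK).
- by exists w'.
Qed.

End AutomorphismKinds.

Section AutomorphismLabels.
Context (m n : core -> core).
Hypotheses (m_homo : forall x y, core_le x y -> core_le (m x) (m y))
           (n_homo : forall x y, core_le x y -> core_le (n x) (n y))
           (mK : cancel m n) (nK : cancel n m).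

(** Below [cT] there are only [cV], [cU], [cE] and [cT] itself; the inverse [n] preserves the kinds
    [cV] and [cE], and [m] fixes [cT]. *)
Lemma core_aut_U h : exists h', m (cU h) = cU h'.
Proof.
have := @m_homo (cU h) cT I; rewrite (core_aut_T n_homo mK nK).
case mU: (m (cU h)) => [h'|h'||h' w|w||] //= _; last 1 first.
- by move: mU; rewrite -(core_aut_T n_homo mK nK) => /(can_inj mK).
- have [h'' nV] := core_aut_V n_homo m_homo nK mK h'.
  by have := mK (cU h); rewrite mU nV.
- by exists h'.
- have [h'' [w'' nE]] := core_aut_E n_homo nK h' w.
  by have := mK (cU h); rewrite mU nE.
Qed.

(** The point [cE a b] is below [cC w] when [b <= w]. Pulling [cE 1 (s w)] back along [n] gives a
    label below [w], hence below [w']; pushing forward along [m] compares [s w] with [s w']. *)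
Lemma core_aut_C_homo s t :
  (forall w, m (cC w) = cC (s w)) -> (forall w, n (cC w) = cC (t w)) ->
  {homo s : x y / r x y}.
Proof.
move=> sE tE w w' ww'.
have := @n_homo (cE 1 (s w)) (cC (s w)) (well_order_refl r_wo _).
have [a [b nE]] := core_aut_E n_homo nK 1 (s w).
rewrite nE -sE mK /= => bw.
have := @m_homo (cE a b) (cC w') (well_order_trans r_wo bw ww').
by rewrite -nE nK sE.
Qed.

End AutomorphismLabels.

Hypothesis pi_surj : forall h, exists w, pi w = h.

(** Rigidity of the well-order fixes the labels, so the map induced on [H] commutes with right
    translation by every [pi w]; as [pi] is onto, it is a left translation. *)
Lemma core_aut (m n : core -> core) :
  (forall x y, core_le x y -> core_le (m x) (m y)) ->
  (forall x y, core_le x y -> core_le (n x) (n y)) ->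
  cancel m n -> cancel n m -> exists a, m =1 core_mul a.
Proof.
move=> m_homo n_homo mK nK.
have /choice[s sE] := core_aut_C m_homo n_homo mK nK.
have /choice[t tE] := core_aut_C n_homo m_homo nK mK.
have /choice[al alE] := core_aut_V m_homo n_homo mK nK.
have /choice[be beE] := core_aut_U m_homo n_homo mK nK.
have s_id : s =1 id.
  apply: (well_order_rigid r_wo (t := t)).
  - exact: core_aut_C_homo sE tE.
  - exact: core_aut_C_homo tE sE.
  - by move=> w; have := mK (cC w); rewrite sE tE => -[].
  - by move=> w; have := nK (cC w); rewrite tE sE => -[].
have t_id w : t w = w.
  by have := mK (cC w); rewrite sE tE s_id => -[].
have mE h w : m (cE h w) = cE (al h) w.
  have [h' [w' E]] := core_aut_E m_homo mK h w.
  have := @m_homo (cV h) (cE h w) erefl; rewrite alE E /= => ->.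
  (* Applying [m] to [cE h w <= cC w] gives [w' <= w]; applying [n] to [cE h' w' <= cC w'] gives
     [w <= w']. *)
  congr cE; apply: (well_order_anti r_wo); apply/andP; split.
    have := @m_homo (cE h w) (cC w) (well_order_refl r_wo _).
    by rewrite E sE s_id.
  have := @n_homo (cE h' w') (cC w') (well_order_refl r_wo _).
  by rewrite -E mK tE t_id.
have beal h w : be (h * pi w) = al h * pi w.
  by have := @m_homo (cU (h * pi w)) (cE h w) erefl; rewrite beE mE.
have beE' h : be h = al h by have := beal h w1; rewrite pi_w1 !mulg1.
have al1 h : al h = al 1 * h.
  by have [w <-] := pi_surj h; rewrite -beal beE' mul1g.
exists (al 1); case=> [h|h||h w|w||] /=.
- by rewrite alE al1.
- by rewrite beE beE' al1.
- exact: core_aut_O mK nK.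
- by rewrite mE al1.
- by rewrite sE s_id.
- exact: core_aut_T mK nK.
- exact: core_aut_D mK nK.
Qed.

End Core.

Arguments cV {H W}.
Arguments cU {H W}.
Arguments cO {H W}.
Arguments cE {H W}.
Arguments cC {H W}.
Arguments cT {H W}.
Arguments cD {H W}.

(** * The Alexandrov topology of a preorder *)

Definition alexandrov (T : Type) (le : T -> T -> Prop) : Type := T.

Section AlexandrovTopology.
Context (T : Type) (le : T -> T -> Prop).

HB.instance Definition _ := gen_eqMixin (alexandrov le).
HB.instance Definition _ := gen_choiceMixin (alexandrov le).

Definition down_closed : set (set (alexandrov le)) :=
  [set U | forall x y, le x y -> U y -> U x].

Let down_closedT : down_closed setT. Proof. by []. Qed.

Let down_closedI : setI_closed down_closed.
Proof.
by move=> U V dU dV x y xy [Uy Vy]; split; [exact: dU Uy|exact: dV Vy].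
Qed.

Let down_closed_bigU (I : Type) (U : I -> set (alexandrov le)) :
  (forall i, down_closed (U i)) -> down_closed (\bigcup_i U i).
Proof. by move=> dU x y xy [i _ Uiy]; exists i => //; exact: dU Uiy. Qed.

HB.instance Definition _ := isOpenTopological.Build (alexandrov le)
  down_closedT down_closedI down_closed_bigU.

Lemma open_alexandrovE (U : set (alexandrov le)) :
  open U <-> forall x y, le x y -> U y -> U x.
Proof. by []. Qed.

Hypotheses (le_refl : forall x, le x x)
           (le_trans : forall y x z, le x y -> le y z -> le x z).

(** The principal down-set of [x] is its smallest neighbourhood. *)
Lemma nbhs_alexandrovP (x : alexandrov le) (U : set (alexandrov le)) :
  nbhs x U <-> forall y, le y x -> U y.
Proof.
rewrite nbhsE; split.
  by move=> [V [/open_alexandrovE Vo Vx] VU] y yx; apply: VU; exact: Vo Vx.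
move=> xU; exists [set y | le y x] => //; split; last exact: le_refl.
by apply/open_alexandrovE => y z yz /=; exact: le_trans.
Qed.

End AlexandrovTopology.

(** * Continuous maps and homotopies between Alexandrov spaces *)

Section Monotone.
Context (S T : Type) (leS : S -> S -> Prop) (leT : T -> T -> Prop).
Hypotheses (leS_refl : forall x, leS x x)
           (leS_trans : forall y x z, leS x y -> leS y z -> leS x z)
           (leT_refl : forall x, leT x x)
           (leT_trans : forall y x z, leT x y -> leT y z -> leT x z).

Lemma continuous_alexandrovP (m : alexandrov leS -> alexandrov leT) :
  continuous m <-> forall x y, leS x y -> leT (m x) (m y).
Proof.
split=> [mc x y xy|m_homo x U].
  have : nbhs (m y) [set z | leT z (m y)] by apply/nbhs_alexandrovP.
  by move=> /(mc y) /nbhs_alexandrovP; apply.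
move=> /nbhs_alexandrovP mU; apply/nbhs_alexandrovP => // y yx.
by apply: mU => //; exact: m_homo.
Qed.

Context (R : realType).

Local Open Scope ring_scope.

(* The homotopy stays at [a] for [t < 1] and jumps to [b] at [t = 1]. *)
Lemma homotopic_le (a b : alexandrov leS -> alexandrov leT) :
  continuous a -> continuous b -> (forall x, leT (a x) (b x)) ->
  homotopic R a b.
Proof.
move=> /continuous_alexandrovP ac /continuous_alexandrovP bc ab.
exists (fun p => if p.1 < 1 then a p.2 else b p.2); split; last 2 first.
- by move=> x /=; rewrite ltr01.
- by move=> x /=; rewrite ltxx.
apply: continuous_subspaceT => -[t x] U /nbhs_alexandrovP xU.
have {xU} : forall y, leT y (if t < 1 then a x else b x) -> U y by exact: xU.
case: ifPn => [t1 xU|t1 xU].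
  exists ([set s | s < 1], [set y | leS y x]) => /=.
    split; last by apply/nbhs_alexandrovP.
    by apply: open_nbhs_nbhs; split => //; exact: open_lt.
  by move=> [s y] /= [-> yx]; apply: xU; exact: ac.
(* Time needs no restriction here: at times below 1 the value [a y] is still below [b x]. *)
exists (setT, [set y | leS y x]) => /=.
  by split; [exact: filterT|apply/nbhs_alexandrovP].
move=> [s y] /= [_ yx]; apply: xU; case: ifP => _; last exact: bc.
by apply: leT_trans (ab _) _; exact: bc.
Qed.

(** The smallest neighbourhood of [F (t, x)] pulls back to a neighbourhood containing a box whose
    space side contains the down-set of [x]. Taking [s = t] gives monotone slices, and [y = x] gives
    semicontinuity in time. *)
Lemma homotopy_near_le (F : R * alexandrov leS -> alexandrov leT) (t : R) x :
  {within `[0, 1] `*` [set: alexandrov leS], continuous F} -> `[0, 1]%classic t ->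
  \forall s \near t, `[0, 1]%classic s -> forall y, leS y x -> leT (F (s, y)) (F (t, x)).
Proof.
move=> /subspace_continuousP /(_ (t, x)) Fc t01.
have /Fc : nbhs (F (t, x)) [set z | leT z (F (t, x))] by apply/nbhs_alexandrovP.
move=> /(_ (conj t01 I)) [[P Q] /= [Pt /nbhs_alexandrovP Qx] PQ].
near=> s => s01 y yx; apply: (PQ (s, y)) => //; split => /=; last exact: Qx.
by near: s.
Unshelve. all: by end_near. Qed.

(** [B] is locally constant on a connected segment: the open sets [U] and [V] trace on it the times
    where [B] holds and where it fails. *)
Lemma segment_clopen_ind (B : R -> Prop) : B 0 ->
  (forall t : R, `[0, 1]%classic t -> \forall s \near t, `[0, 1]%classic s -> (B t <-> B s)) ->
  forall t : R, `[0, 1]%classic t -> B t.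
Proof.
move=> B0 Bloc.
pose U := interior [set s | `[0, 1]%classic s -> B s].
pose V := interior [set s | `[0, 1]%classic s -> ~ B s].
have UE (t : R) : `[0, 1]%classic t -> U t <-> B t.
  move=> t01; split=> [/nbhs_singleton|Bt]; first exact.
  by apply: filterS (Bloc t t01) => s /= + s01 => /(_ s01) <-.
have VE (t : R) : `[0, 1]%classic t -> V t <-> ~ B t.
  move=> t01; split=> [/nbhs_singleton|Bt]; first exact.
  by apply: filterS (Bloc t t01) => s /= + s01 => /(_ s01) <-.
have UV : `[0, 1]%classic `&` U = `[0, 1]%classic.
  apply: (@segment_connected R 0 1).
  - have z01 : `[0, 1]%classic (0 : R) by rewrite /= in_itv /= lexx ler01.
    by exists 0; split => //; apply/UE.
  - by exists U => //; exact: open_interior.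
  - exists (~` V); first by apply: open_closedC; exact: open_interior.
    apply/seteqP; split => t [t01].
      by move=> /(UE _ t01) Bt; split => //; exact: (fun Vt => (VE _ t01).1 Vt Bt).
    move=> nVt; split => //; apply/(UE _ t01); apply: contrapT => nBt.
    by apply: nVt; apply/(VE _ t01).
by move=> t t01; apply/(UE _ t01); move: (t01); rewrite -{1}UV => -[].
Qed.

(* On a finite set on which every monotone map lying above or below [a] is [a],
   the set of times at which a homotopy starting at [a] agrees with [a] is
   clopen in [[0, 1]]. *)
Lemma homotopic_finite_rigid (s : seq S) (a b : alexandrov leS -> alexandrov leT) :
  (forall g : S -> T, (forall x y, leS x y -> leT (g x) (g y)) ->
    (forall x, List.In x s -> leT (g x) (a x)) ->
    forall x, List.In x s -> g x = a x) ->
  (forall g : S -> T, (forall x y, leS x y -> leT (g x) (g y)) ->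
    (forall x, List.In x s -> leT (a x) (g x)) ->
    forall x, List.In x s -> g x = a x) ->
  homotopic R a b -> forall x, List.In x s -> b x = a x.
Proof.
move=> below above [F [Fc F0 F1]].
have Fhomo (t : R) : `[0, 1]%classic t -> forall x y, leS x y -> leT (F (t, x)) (F (t, y)).
  move=> t01 x y xy.
  by have /nbhs_singleton := homotopy_near_le y Fc t01; apply.
(* Finiteness enters here: finitely many neighbourhoods of [t] are intersected. *)
have near_s (t : R) : `[0, 1]%classic t -> forall s', \forall u \near t, `[0, 1]%classic u ->
    forall x, List.In x s' -> leT (F (u, x)) (F (t, x)).
  move=> t01; elim=> [|x s' IH]; first by apply: (@filterE R (nbhs t)) => u _ x [].
  apply: filterS2 IH (homotopy_near_le x Fc t01) => u /= IH xu u01 y [<-|].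
    exact: xu.
  exact: IH.
suff agree : forall t : R, `[0, 1]%classic t -> forall x, List.In x s -> F (t, x) = a x.
  by move=> x xs; rewrite -F1 agree // /= in_itv /= lexx ler01.
apply: segment_clopen_ind => [x _|t t01]; first exact: F0.
(* For [u] near [t] the slice at [u] is below the slice at [t] on [s]. Agreement at [t] thus puts
   the slice at [u] below [a], and agreement at [u] puts the slice at [t] above [a]. *)
apply: filterS (near_s t t01 s) => u /= tu u01; split=> [aE|aE].
  by apply: below (Fhomo u u01) _ => x xs; rewrite -aE //; exact: tu.
by apply: above (Fhomo t t01) _ => x xs; rewrite -aE //; exact: tu.
Qed.

End Monotone.

Lemma inj_surj_bijective (A B : Type) (k : A -> B) :
  injective k -> (forall y, exists x, k x = y) -> bijective k.
Proof.
by move=> kI /choice[k' kk']; exists k' => // x; apply: kI; rewrite kk'.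
Qed.

(** * The mapping cylinder attached to a homomorphism *)

Section Realization.
Local Open Scope group_scope.
Context (R : realType) (G H : groupType) (f : {multiplicative G -> H}).
Context (r : rel (G + H)%type).
Hypothesis r_wo : well_order r.

Let fM : {morph f : x y / x * y} .
Proof. exact: gmulfM. Qed.

Let f1 : f 1 = 1.
Proof. by apply: (@mulgI H (f 1)); rewrite -fM !mulg1. Qed.

(** Labels from [H] realize all right translations of [H]; labels from [G] are the ones lifted to
    the fibres. The two units give distinct labels of trivial value. *)
Definition label_val (w : G + H) : H :=
  match w with inl g => f g | inr h => h end.

Notation core := (core H (G + H)%type).
Notation core_le := (core_le r label_val).

Let w1 : G + H := inl 1.
Let w2 : G + H := inr 1.
Let w12 : w1 <> w2. Proof. by []. Qed.
Let val_w1 : label_val w1 = 1. Proof. exact: f1. Qed.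
Let val_w2 : label_val w2 = 1. Proof. by []. Qed.
Let val_surj h : exists w, label_val w = h. Proof. by exists (inr h). Qed.

Let c_refl := @core_le_refl _ _ r label_val.
Let c_trans := @core_le_trans _ _ r label_val.
Let c_anti := @core_le_anti _ _ r label_val.

(** Sources, targets and right translations as in the core, but for [G] acting on itself; [fib_base]
    records the label [s] in the core, where it is rigid. *)
Inductive fib := pV of G | pU of G | pE of G & G.

Definition fib_le (p q : fib) : Prop :=
  match p, q with
  | pV g, pV g' => g = g'
  | pV g, pE g' _ => g = g'
  | pU g, pU g' => g = g'
  | pU g, pE g' s => g = g' * s
  | pE g s, pE g' s' => g = g' /\ s = s'
  | _, _ => False
  end.

Definition fib_base (p : fib) : core :=
  match p with
  | pV g => cV (f g)
  | pU g => cU (f g)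
  | pE g s => cE (f g) (inl s)
  end.

Definition fib_mul (a : G) (p : fib) : fib :=
  match p with
  | pV g => pV (a * g)
  | pU g => pU (a * g)
  | pE g s => pE (a * g) s
  end.

Definition cyl : Type := core + fib.

Definition cyl_le (x y : cyl) : Prop :=
  match x, y with
  | inl c, inl d => core_le c d
  | inl _, inr _ => False
  | inr p, inl d => core_le (fib_base p) d
  | inr p, inr q => fib_le p q
  end.

Lemma fib_base_homo p q : fib_le p q -> core_le (fib_base p) (fib_base q).
Proof.
by case: p => [g|g|g s]; case: q => [g'|g'|g' s'] //=;
  intuition (subst; rewrite /= ?fM).
Qed.

Lemma cyl_le_refl x : cyl_le x x.
Proof. by case: x => [c|[]] //=; exact: c_refl. Qed.

Lemma cyl_le_trans y x z : cyl_le x y -> cyl_le y z -> cyl_le x z.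
Proof.
case: x => [c|p]; case: y => [d|q]; case: z => [e|o] //=.
- exact: c_trans.
- exact: c_trans.
- by move=> /fib_base_homo; exact: c_trans.
- by case: p => [?|?|? ?]; case: q => [?|?|? ?] //=; case: o => [?|?|? ?] //=;
    intuition (subst => //).
Qed.

Lemma cyl_le_anti x y : cyl_le x y -> cyl_le y x -> x = y.
Proof.
case: x => [c|p]; case: y => [d|q] //=.
  by move=> /c_anti cd /cd ->.
by case: p => [?|?|? ?]; case: q => [?|?|? ?] //=; intuition (subst => //).
Qed.

Definition ret (x : cyl) : core :=
  match x with inl c => c | inr p => fib_base p end.

Lemma ret_homo x y : cyl_le x y -> core_le (ret x) (ret y).
Proof. by case: x => [c|p]; case: y => [d|q] //=; exact: fib_base_homo. Qed.

Lemma le_ret x : cyl_le x (inl (ret x)).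
Proof. by case: x => [c|p] /=; exact: c_refl. Qed.

Definition cyl_space : topologicalType := alexandrov cyl_le.
Definition core_space : topologicalType := alexandrov core_le.

Notation X := cyl_space.
Notation A := core_space.

Let contXX (m : X -> X) :
  continuous m <-> forall x y, cyl_le x y -> cyl_le (m x) (m y).
Proof.
exact: (continuous_alexandrovP cyl_le_refl cyl_le_trans cyl_le_refl cyl_le_trans).
Qed.

Let ret_cont : continuous (ret : X -> A).
Proof.
by apply/(continuous_alexandrovP cyl_le_refl cyl_le_trans c_refl c_trans);
  exact: ret_homo.
Qed.

Let inl_cont : continuous (inl : A -> X).
Proof. by apply/(continuous_alexandrovP c_refl c_trans cyl_le_refl cyl_le_trans). Qed.

Let comp_cont (S T U : topologicalType) (k : T -> U) (l : S -> T) :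
  continuous k -> continuous l -> continuous (k \o l).
Proof. by move=> kc lc x; apply: continuous_comp; [exact: lc|exact: kc]. Qed.

Let id_cont (S : topologicalType) : continuous (@id S).
Proof. by move=> x; exact: cvg_id. Qed.

Let ret_htpy : homotopic R (@id X) (inl \o ret : X -> X).
Proof.
apply: (homotopic_le cyl_le_refl cyl_le_trans cyl_le_refl cyl_le_trans).
- exact: id_cont.
- exact: (comp_cont (l := (ret : X -> A)) (k := (inl : A -> X))).
- exact: le_ret.
Qed.

(** * Homotopy classes of self-equivalences of the cylinder *)

Lemma core_rigid (m : A -> A) : homotopic R id m -> m =1 id.
Proof.
move=> m_id x; have [h [w xS]] := core_starP label_val w1 w2 x.
apply: (homotopic_finite_rigid c_refl c_trans c_refl c_trans _ _ m_id) xS.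
- exact: (core_star_le r_wo w12 val_w1 val_w2).
- exact: (core_star_ge r_wo w12 val_w1 val_w2).
Qed.

Definition core_map (m : X -> X) (c : A) : A := ret (m (inl c)).

(** As [inl \o ret] is homotopic to the identity, the composite is homotopic to
    [ret \o (n \o m) \o inl], hence to [ret \o inl], which is the identity; [core_rigid] turns this
    into an equality. *)
Lemma core_mapK (m n : X -> X) : continuous m -> continuous n ->
  homotopic R (n \o m) id -> cancel (core_map m) (core_map n).
Proof.
move=> mc nc nm; apply: core_rigid; apply: homotopic_sym.
have mi : continuous (m \o inl : A -> X) by exact: comp_cont.
have rn : continuous (ret \o n : X -> A) by exact: comp_cont.
have H1 : homotopic R (core_map n \o core_map m) (ret \o (n \o m) \o inl).
  apply: (@homotopic_comp R A X A (inl \o ret \o (m \o inl)) (m \o inl)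
    (ret \o n) (ret \o n)) => //.
  - by apply: comp_cont => //; exact: (comp_cont (T := A)).
  - apply: (@homotopic_comp R A X X (m \o inl) (m \o inl) (inl \o ret) id) => //.
      exact: homotopic_refl.
    exact: homotopic_sym.
  - exact: homotopic_refl.
apply: homotopic_trans H1 _.
apply: (@homotopic_comp R A X A inl inl (ret \o (n \o m)) ret) => //.
  exact: homotopic_refl.
apply: (@homotopic_comp R X X A (n \o m) id ret ret) => //.
  exact: comp_cont.
exact: homotopic_refl.
Qed.

Lemma core_map_homo (m : X -> X) : continuous m ->
  forall x y, core_le x y -> core_le (core_map m x) (core_map m y).
Proof. by move=> /contXX m_homo x y xy; apply: ret_homo; exact: m_homo. Qed.

Lemma core_mapE (m n : X -> X) : continuous m -> continuous n ->
  homotopic R (n \o m) id -> homotopic R (m \o n) id ->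
  exists a, core_map m =1 core_mul a /\ core_map n =1 core_mul a^-1.
Proof.
move=> mc nc nm mn; have mK := core_mapK mc nc nm; have nK := core_mapK nc mc mn.
have [a ma] := core_aut r_wo val_w1 val_surj
  (core_map_homo mc) (core_map_homo nc) mK nK.
exists a; split => // c; apply: (can_inj mK).
by rewrite nK ma core_mulVK.
Qed.

(** Retracting first lets all of [H] act, at the price that [core_act 1] is the retraction, which is
    only homotopic to the identity. *)
Definition core_act (h : H) (x : X) : X := inl (core_mul h (ret x)).

Lemma core_act_cont h : continuous (core_act h).
Proof.
by apply/contXX => x y xy; apply: core_mul_homo; exact: ret_homo.
Qed.

Lemma core_actM h h' : core_act (h * h') = core_act h \o core_act h'.
Proof. by apply/funext => x; rewrite /core_act /= core_mulM. Qed.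

Lemma core_act1 : core_act 1 = inl \o ret.
Proof. by apply/funext => x; rewrite /core_act /= core_mul1. Qed.

Lemma core_act_equiv h : homotopy_equivalence R (core_act h).
Proof.
split; first exact: core_act_cont.
exists (core_act h^-1); split; first exact: core_act_cont.
- by rewrite -core_actM mulVg core_act1; exact: homotopic_sym.
- by rewrite -core_actM mulgV core_act1; exact: homotopic_sym.
Qed.

Definition core_act_class (h : H) : Eself R X :=
  \pi_(Eself R X)%qT (MkSelfHE (core_act_equiv h)).

Lemma core_act_classM : {morph core_act_class : h k / h * k}.
Proof.
move=> h k; rewrite [RHS]Eself_mulE; apply/EselfP => /=.
by rewrite core_actM; apply: homotopic_refl; apply: comp_cont; exact: core_act_cont.
Qed.

HB.instance Definition _ :=
  isMultiplicative.Build H (Eself R X) core_act_class core_act_classM.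

(** Up to homotopy, [m] may be composed with the retraction on both sides, and the result depends
    only on [core_map m]. *)
Lemma core_act_htpy (m : X -> X) h : continuous m ->
  core_map m =1 core_mul h -> homotopic R m (core_act h).
Proof.
move=> mc mE.
have -> : core_act h = inl \o ret \o (m \o (inl \o ret)).
  by apply/funext => x; rewrite /core_act /= -mE.
have ri : continuous (inl \o ret : X -> X) by exact: (comp_cont (T := A)).
apply: (@homotopic_comp R X X X m (m \o (inl \o ret)) id) => //.
apply: (@homotopic_comp R X X X id (inl \o ret) m m) => //.
exact: homotopic_refl.
Qed.

Lemma core_act_class_inj : injective core_act_class.
Proof.
move=> h k /EselfP /= hk.
have : homotopic R (core_act k^-1 \o core_act h) id.
  apply: (@homotopic_trans _ _ _ _ (core_act k^-1 \o core_act k)).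
    apply: homotopic_comp => //; first exact: core_act_cont.
      exact: core_act_cont.
    by apply: homotopic_refl; exact: core_act_cont.
  by rewrite -core_actM mulVg core_act1; exact: homotopic_sym.
(* Evaluation at [cV 1] reads off [k^-1 * (h * 1) = 1]. *)
move=> /core_mapK - /(_ (@core_act_cont _) (@core_act_cont _)) /(_ (cV 1)).
by move=> [] /(congr1 (fun b : H => k * b)) /=; rewrite !mulg1 mulVKg.
Qed.

Lemma core_act_class_surj y : exists h, core_act_class h = y.
Proof.
elim/quotW: y => m; have [mc [n [nc nm mn]]] := selfHE_equiv m.
have [a [ma _]] := core_mapE mc nc nm mn.
by exists a; apply/EselfP => /=; apply: homotopic_sym; exact: core_act_htpy.
Qed.

(** * Homeomorphisms of the cylinder *)

Definition cyl_mul (g : G) (x : X) : X :=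
  match x with
  | inl c => inl (core_mul (f g) c)
  | inr p => inr (fib_mul g p)
  end.

Lemma fib_base_mul g p : fib_base (fib_mul g p) = core_mul (f g) (fib_base p).
Proof. by case: p => [?|?|? ?] /=; rewrite fM. Qed.

Lemma fib_mul_homo g p q : fib_le p q -> fib_le (fib_mul g p) (fib_mul g q).
Proof.
by case: p => [?|?|? ?]; case: q => [?|?|? ?] //=; intuition (subst; rewrite ?mulgA).
Qed.

Lemma cyl_mul_cont g : continuous (cyl_mul g).
Proof.
apply/contXX => -[c|p] [d|q] //=; rewrite ?fib_base_mul.
- exact: core_mul_homo.
- exact: core_mul_homo.
- exact: fib_mul_homo.
Qed.

Lemma cyl_mulM g g' : cyl_mul (g * g') = cyl_mul g \o cyl_mul g'.
Proof.
apply/funext => -[c|p] /=; first by rewrite fM core_mulM.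
by case: p => [?|?|? ?] /=; rewrite mulgA.
Qed.

Lemma cyl_mul1 : cyl_mul 1 = id.
Proof.
apply/funext => -[c|p] /=; first by rewrite f1 core_mul1.
by case: p => [?|?|? ?] /=; rewrite mul1g.
Qed.

Lemma cyl_mul_homeo g : homeomorphism (cyl_mul g).
Proof.
split; first exact: cyl_mul_cont.
exists (cyl_mul g^-1); split; first exact: cyl_mul_cont.
- by move=> x; rewrite -[LHS]/((cyl_mul g^-1 \o cyl_mul g) x) -cyl_mulM mulVg cyl_mul1.
- by move=> x; rewrite -[LHS]/((cyl_mul g \o cyl_mul g^-1) x) -cyl_mulM mulgV cyl_mul1.
Qed.

Definition cyl_aut (g : G) : Aut X := MkAut (cyl_mul_homeo g).

Lemma cyl_autM : {morph cyl_aut : g h / g * h}.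
Proof. by move=> g h; apply: AutP => x /=; rewrite cyl_mulM. Qed.

HB.instance Definition _ := isMultiplicative.Build G (Aut X) cyl_aut cyl_autM.

Lemma cyl_aut_inj : injective cyl_aut.
Proof.
move=> g h /(congr1 (fun k : Aut X => k (inr (pV 1)))) /= [].
by rewrite !mulg1.
Qed.

(** By [le_ret], on the core [k] and [k'] lie below the translations by [a] and [a^-1]; applying
    each map to the inequality for the other gives the reverse inequalities. *)
Lemma homeo_core (k k' : X -> X) : continuous k -> continuous k' ->
  cancel k k' -> cancel k' k ->
  exists a, (forall c, k (inl c) = inl (core_mul a c)) /\
            (forall c, k' (inl c) = inl (core_mul a^-1 c)).
Proof.
move=> kc k'c kK k'K.
have k'k : k' \o k = id by apply/funext => x /=.
have kk' : k \o k' = id by apply/funext => x /=.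
have [a [ka k'a]] : exists a,
    core_map k =1 core_mul a /\ core_map k' =1 core_mul a^-1.
  by apply: core_mapE => //; rewrite ?k'k ?kk'; exact: homotopic_refl.
have k_le c : cyl_le (k (inl c)) (inl (core_mul a c)).
  by rewrite -ka; exact: le_ret.
have k'_le c : cyl_le (k' (inl c)) (inl (core_mul a^-1 c)).
  by rewrite -k'a; exact: le_ret.
exists a; split=> c; apply: cyl_le_anti => //.
  have /contXX := kc; move=> /(_ _ _ (k'_le (core_mul a c))).
  by rewrite k'K core_mulK.
have /contXX := k'c; move=> /(_ _ _ (k_le (core_mul a^-1 c))).
by rewrite kK core_mulVK.
Qed.

Lemma cyl_aut_surj (k : Aut X) : exists g, cyl_aut g = k.
Proof.
have [kc [k' [k'c kK k'K]]] := Aut_homeo k.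
have [a [ka k'a]] := homeo_core kc k'c kK k'K.
have /contXX k_homo := kc; have /contXX k'_homo := k'c.
(* A fibre point cannot enter the core, which [k'] preserves. Moreover [fib_base p] is the least
   core point above [p], so [k] carries it to the least core point above [k (inr p)]. *)
have kfib p : exists2 q, k (inr p) = inr q & fib_base q = core_mul a (fib_base p).
  case kp: (k (inr p)) => [c|q].
    by have := kK (inr p); rewrite kp k'a.
  exists q => //; apply: c_anti.
    by have := @k_homo (inr p) (inl (fib_base p)) (c_refl _); rewrite kp ka.
  have := @k'_homo (inr q) (inl (fib_base q)) (c_refl _).
  rewrite -kp kK k'a /= => /(@core_mul_homo _ _ r label_val a).
  by rewrite core_mulVK.
have kV g : exists g', k (inr (pV g)) = inr (pV g') /\ f g' = a * f g.
  by have [[g'|g'|g' s] kE //= [E]] := kfib (pV g); exists g'.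
have kU g : exists g', k (inr (pU g)) = inr (pU g').
  by have [[g'|g'|g' s] kE //= [E]] := kfib (pU g); exists g'.
(* The label [s] is visible in [fib_base], and [core_mul a] does not change it. *)
have kE g s : exists g', k (inr (pE g s)) = inr (pE g' s).
  by have [[g'|g'|g' s'] kE //= [_ E]] := kfib (pE g s); exists g'; rewrite kE E.
have /choice[al /all_and2[alE fal]] := kV.
have /choice[be beE] := kU.
have kE' g s : k (inr (pE g s)) = inr (pE (al g) s).
  have [g' E] := kE g s; rewrite E; congr (inr (pE _ _)).
  by have := @k_homo (inr (pV g)) (inr (pE g s)) erefl; rewrite alE E /= => ->.
(* As in [core_aut], targets force [al] to commute with right translations, now those of [G]. *)
have be_al g s : be (g * s) = al g * s.
  by have := @k_homo (inr (pU (g * s))) (inr (pE g s)) erefl; rewrite beE kE'.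
have be_alE g : be g = al g by rewrite -[g in LHS]mulg1 be_al mulg1.
have al1 g : al g = al 1 * g by rewrite -be_al mul1g be_alE.
have aE : f (al 1) = a by rewrite fal f1 mulg1.
exists (al 1); apply: AutP => -[c|[g|g|g s]] /=.
- by rewrite aE ka.
- by rewrite alE -al1.
- by rewrite beE be_alE -al1.
- by rewrite kE' -al1.
Qed.

(** The class is determined by the map induced on the core, where [cyl_mul g] is the translation by
    [f g]. *)
Lemma tau_cyl_aut g : tau R X (cyl_aut g) = core_act_class (f g).
Proof.
by apply/EselfP; apply: core_act_htpy => //=; exact: cyl_mul_cont.
Qed.

Lemma realization :
  exists (Y : topologicalType) (phi : {multiplicative G -> Aut Y})
         (psi : {multiplicative H -> Eself R Y}),
    [/\ bijective phi, bijective psi & tau R Y \o phi =1 psi \o f].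
Proof.
exists X, cyl_aut, core_act_class; split.
- exact: inj_surj_bijective cyl_aut_inj cyl_aut_surj.
- exact: inj_surj_bijective core_act_class_inj core_act_class_surj.
- exact: tau_cyl_aut.
Qed.

End Realization.

Theorem theorem1p2 (R : realType) (G H : groupType) (f : {multiplicative G -> H}) :
  exists (X : topologicalType) (phi : {multiplicative G -> Aut X})
         (psi : {multiplicative H -> Eself R X}),
    [/\ bijective phi, bijective psi & tau R X \o phi =1 psi \o f].
Proof.
by have [r r_wo] := well_ordering_principle (G + H)%type; exact: realization r_wo.
Qed.
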